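(* Let $\mathcal G$ be a locally finite $\Gamma$-periodic graph with fundamental graph $\mathcal G_*=(\mathcal V_*,\mathcal A_* )$, $\nu=\#\mathcal V_*$, and let $A(k)$, $k\in\mathbb T^d$, be the fiber adjacency operator on $\ell^2(\mathcal V_* )$, with eigenvalues $\lambda_1^o(k),\ldots,\lambda_\nu^o(k)$ counted with multiplicity. Then for each $n\in\mathbb N$: (i) For all $k\in\mathbb T^d$, $$\operatorname{Tr}A^n(k)=\sum_{j=1}^{\nu}\big(\lambda_j^o(k)\big)^n=\sum_{\mathbf c\in\mathcal C_n}\cos\langle\tau(\mathbf c),k\rangle=\sum_{\mathrm m\in\mathbb Z^d,\ \|\mathrm m\|\le n\tau_+}\mathcal N_n^{\mathrm m}\cos\langle \mathrm m,k\rangle ,$$ and moreover $\big|\operatorname{Tr}A^n(k)\big|\le \operatorname{Tr}A^n(0)=\mathcal N_n$. (ii) $$\frac1{(2\pi)^d}\int_{\mathbb T^d}\operatorname{Tr}A^n(k)\,dk=\mathcal N_n^0\ge 0 .$$ (iii) The fundamental graph $\mathcal G_*$ is bipartite if and only if $\operatorname{Tr}A^n(0)=0$ for all odd $n\le\nu$. (iv) The periodic graph $\mathcal G$ is bipartite if and only if $\int_{\mathbb T^d}\operatorname{Tr}A^n(k)\,dk=0$ for all odd $n\in\mathbb N$. Moreover, this condition cannot be reduced: for any $s\in\mathbb N$ there exists a non-bipartite periodic graph $\mathcal G$ such that $\int_{\mathbb T^d}\operatorname{Tr}A^n(k)\,dk=0$ for all odd $n<s$.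
   Context: Periodic graph. $\mathcal G=(\mathcal V,\mathcal E)$ is a connected infinite graph, possibly having loops and multiple edges, embedded into $\mathbb R^d$; $\mathcal V$ is its vertex set, $\mathcal E$ its set of unoriented edges. Each edge in $\mathcal E$ has two orientations, and $\mathcal A$ is the set of all oriented edges. An oriented edge starting at $x$ and ending at $y$ is denoted $(x,y)$ (several edges may have the same end points), and $\underline{\mathbf e}$ is the inverse of $\mathbf e$. $\Gamma\subset\mathbb R^d$ is a lattice of rank $d$ with basis $a_1,\dots,a_d$. The graph is locally finite and $\Gamma$-periodic: $\mathcal G+a=\mathcal G$ for all $a\in\Gamma$, and the quotient (fundamental) graph $\mathcal G_*=\mathcal G/\Gamma=(\mathcal V_*,\mathcal A_* )$ with $\mathcal V_*=\mathcal V/\Gamma$, $\mathcal A_*=\mathcal A/\Gamma$ is finite. Edge index. Let $\Omega=\{\sum_s t_sa_s:\ t_s\in[0,1)\}$. Each $x\in\mathcal V$ is uniquely $x=x_0+[x]$ with $x_0\in\Omega$, $[x]\in\Gamma$; $[x]_{\mathbb A}\in\mathbb Z^d$ is the coordinate vector of $[x]$ in the basis $a_1,\dots,a_d$. For $\mathbf e=(x,y)\in\mathcal A$ put $\tau(\mathbf e)=[y]_{\mathbb A}-[x]_{\mathbb A}\in\mathbb Z^d$. This is $\Gamma$-invariant, so it induces the index $\tau(\mathbf e)$ for $\mathbf e\in\mathcal A_*$. One has $\tau(\underline{\mathbf e})=-\tau(\mathbf e)$. Put $\tau_+=\max_{\mathbf e\in\mathcal A_*}\|\tau(\mathbf e)\|$,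 with $\|\cdot\|$ the standard norm in $\mathbb R^d$. Cycles. A cycle of length $n\geq 1$ in a graph is a sequence $\mathbf c=(\mathbf e_1,\dots,\mathbf e_n)$ of oriented edges $\mathbf e_s=(x_{s-1},x_s)$ with $x_0=x_n$ (a closed walk; the starting point and direction matter, and backtracking is allowed); $|\mathbf c|=n$. For a cycle in $\mathcal G_*$ its index is $\tau(\mathbf c)=\sum_{s}\tau(\mathbf e_s)$. $\mathcal C_n$ is the set of all cycles of length $n$ in $\mathcal G_*$, $\mathcal N_n=\#\mathcal C_n$; for $\mathrm m\in\mathbb Z^d$, $\mathcal C_n^{\mathrm m}=\{\mathbf c\in\mathcal C_n:\tau(\mathbf c)=\mathrm m\}$, $\mathcal N_n^{\mathrm m}=\#\mathcal C_n^{\mathrm m}$. Fiber adjacency operator. With $\mathbb T^d=\mathbb R^d/(2\pi\mathbb Z)^d$, for $k\in\mathbb T^d$, $f\in\ell^2(\mathcal V_* )=\mathbb C^\nu$: $(A(k)f)_x=\sum_{\mathbf e=(x,y)\in\mathcal A_*}e^{i\langle\tau(\mathbf e),k\rangle}f_y$, $x\in\mathcal V_*$. A graph is bipartite if its vertex set is divided into two disjoint sets such that each edge connects vertices from distinct sets. *)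

(* Defs.v *)
From HB Require Import structures.
From mathcomp Require Import all_boot all_order all_algebra.
From mathcomp Require Import finmap.
From mathcomp Require Import complex.
From mathcomp Require Import all_classical all_reals all_analysis.

Set Implicit Arguments.
Unset Strict Implicit.
Unset Printing Implicit Defensive.

Import Order.TTheory GRing.Theory Num.Theory.

Local Open Scope classical_set_scope.
Local Open Scope ring_scope.
Local Open Scope complex_scope.

(* Every unoriented edge, loops included, contributes two distinct oriented
   edges [e] and [inv e]; an unoriented edge is a pair [{e, inv e}]. *)
Record graph : Type := Graph {
  vertex : Type;
  oedge : Type;
  src : oedge -> vertex;
  tgt : oedge -> vertex;
  inv : oedge -> oedge;
  inv_involutive : forall e, inv (inv e) = e;
  inv_neq : forall e, inv e <> e;
  src_inv : forall e, src (inv e) = tgt e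
}.

Fixpoint walk (G : graph) (x : vertex G) (p : seq (oedge G)) (y : vertex G) :=
  if p is e :: p' then src e = x /\ walk (tgt e) p' y else x = y.

Definition connected_graph (G : graph) : Prop :=
  forall x y : vertex G, exists p, walk x p y.

Definition locally_finite (G : graph) : Prop :=
  forall x : vertex G, finite_set [set e : oedge G | src e = x].

Definition bipartite (G : graph) : Prop :=
  exists V1 V2 : set (vertex G),
    [/\ V1 `|` V2 = setT, V1 `&` V2 = set0 &
     forall e : oedge G, (V1 (src e) /\ V2 (tgt e)) \/ (V2 (src e) /\ V1 (tgt e))].

Definition ivec (R : realType) (d : nat) (m : 'rV[int]_d) : 'rV[R]_d :=
  map_mx intr m.

Definition inner (R : realType) (d : nat) (u v : 'rV[R]_d) : R :=
  \sum_s u 0 s * v 0 s.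

(* The Euclidean norm; [`|u|] on row vectors is the sup norm. *)
Definition enorm (R : realType) (d : nat) (u : 'rV[R]_d) : R :=
  Num.sqrt (inner u u).

Definition expi (R : realType) (t : R) : R[i] := cos t +i* sin t.

(* The rows of [basis] are the lattice vectors a_1, ..., a_d, and [vshift m],
   [eshift m] are the translations by m_1 a_1 + ... + m_d a_d.  On vertices the
   translation is the one of R^d; since multiple edges are allowed it has to be
   given separately on edges. *)
Record periodic_graph (R : realType) (d : nat) : Type := PeriodicGraph {
  pgraph :> graph;
  basis : 'M[R]_d;
  basis_unit : basis \in unitmx;
  pos : vertex pgraph -> 'rV[R]_d;
  pos_inj : injective pos;
  vshift : 'rV[int]_d -> vertex pgraph -> vertex pgraph;
  eshift : 'rV[int]_d -> oedge pgraph -> oedge pgraph;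
  pos_vshift : forall m x, pos (vshift m x) = pos x + ivec R m *m basis;
  eshift0 : forall e, eshift 0 e = e;
  eshiftD : forall m m' e, eshift (m + m') e = eshift m (eshift m' e);
  src_eshift : forall m e, src (eshift m e) = vshift m (src e);
  inv_eshift : forall m e, inv (eshift m e) = eshift m (inv e);
  pg_connected : connected_graph pgraph;
  pg_infinite : infinite_set [set: vertex pgraph];
  pg_locally_finite : locally_finite pgraph;
  pg_finite_vquot : finite_set (range (fun x => range (vshift ^~ x)));
  pg_finite_equot : finite_set (range (fun e => range (eshift ^~ e)))
}.

Arguments basis {R d} p.
Arguments vshift {R d p}.
Arguments eshift {R d p}.

Section Periodic.
Variables (R : realType) (d : nat) (G : periodic_graph R d).
Implicit Types (x y : vertex G) (e : oedge G) (m : 'rV[int]_d).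

Lemma tgt_eshift m e : tgt (eshift m e) = vshift m (tgt e).
Proof. by rewrite -!src_inv inv_eshift src_eshift. Qed.

Lemma ivecD m m' : ivec R (m + m') = ivec R m + ivec R m'.
Proof. by rewrite /ivec raddfD. Qed.

Lemma vshift0 x : vshift 0 x = x.
Proof. by apply: pos_inj; rewrite pos_vshift /ivec raddf0 mul0mx addr0. Qed.

Lemma vshiftD m m' x : vshift (m + m') x = vshift m (vshift m' x).
Proof.
by apply: pos_inj; rewrite !pos_vshift ivecD mulmxDl addrAC addrA.
Qed.

Definition Omega : set 'rV[R]_d :=
  [set u | exists2 t : 'rV[R]_d, forall s, 0 <= t 0 s < 1 & u = t *m basis G].

(* The coordinate vector of [x]: integer parts of the coordinates of x in the
   basis a_1, ..., a_d, see [vcellP]. *)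
Definition vcell x : 'rV[int]_d := map_mx Num.floor (pos x *m invmx (basis G)).

Lemma vcellP x m : Omega (pos x - ivec R m *m basis G) <-> m = vcell x.
Proof.
split=> [[t t01 /eqP]|->].
  rewrite subr_eq => /eqP xE; apply/rowP => s.
  rewrite /vcell mxE xE -mulmxDl mulmxK ?basis_unit// !mxE.
  apply/esym/floor_def; have /andP[t0 t1] := t01 s.
  by rewrite intrD lerDr t0 addrC ltrD2l t1.
exists (pos x *m invmx (basis G) - ivec R (vcell x)).
  move=> s; rewrite !mxE; set c := \sum_(_ | _) _.
  by rewrite subr_ge0 ltrBlDl floor_le -[1]/(1%:~R) -intrD floorD1_gt.
by rewrite mulmxBl mulmxKV ?basis_unit.
Qed.

Definition etau e : 'rV[int]_d := vcell (tgt e) - vcell (src e).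

Lemma vcell_vshift m x : vcell (vshift m x) = vcell x + m.
Proof.
apply/esym/vcellP; rewrite pos_vshift ivecD mulmxDl opprD addrACA subrr addr0.
by apply/vcellP.
Qed.

Lemma etau_eshift m e : etau (eshift m e) = etau e.
Proof.
by rewrite /etau tgt_eshift src_eshift !vcell_vshift opprD addrACA subrr addr0.
Qed.

Definition vorbit x : set (vertex G) := range (vshift ^~ x).
Definition eorbit e : set (oedge G) := range (eshift ^~ e).

Definition qvertex : finType := fset_set (range vorbit).
Definition qedge : finType := fset_set (range eorbit).

Lemma vorbit_mem x : vorbit x \in fset_set (range vorbit).
Proof.
by rewrite in_fset_set ?inE; [exists x|exact: pg_finite_vquot].
Qed.

Lemma eorbit_mem e : eorbit e \in fset_set (range eorbit).
Proof.
by rewrite in_fset_set ?inE; [exists e|exact: pg_finite_equot].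
Qed.

Definition vproj x : qvertex := FSetSub (vorbit_mem x).
Definition eproj e : qedge := FSetSub (eorbit_mem e).

Lemma vproj_eq x y : vproj x = vproj y <-> exists m, y = vshift m x.
Proof.
split=> [/(congr1 val)/= xy|[m ->]].
  have : vorbit y y by exists 0 => //; rewrite vshift0.
  by rewrite -xy => -[m _ <-]; exists m.
apply/val_inj => /=; apply/seteqP; split=> z [m' _ <-].
  by exists (m' - m) => //; rewrite -vshiftD subrK.
by exists (m' + m) => //; rewrite vshiftD.
Qed.

Lemma eproj_eq e e' : eproj e = eproj e' <-> exists m, e' = eshift m e.
Proof.
split=> [/(congr1 val)/= ee'|[m ->]].
  have : eorbit e' e' by exists 0 => //; rewrite eshift0.
  by rewrite -ee' => -[m _ <-]; exists m.
apply/val_inj => /=; apply/seteqP; split=> z [m' _ <-].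
  by exists (m' - m) => //; rewrite -eshiftD subrK.
by exists (m' + m) => //; rewrite eshiftD.
Qed.

Lemma eproj_surj (E : qedge) : exists e, eproj e = E.
Proof.
have := fsvalP E; rewrite in_fset_set ?inE; last exact: pg_finite_equot.
by move=> -[e _ eE]; exists e; apply/val_inj.
Qed.

Lemma vproj_surj (X : qvertex) : exists x, vproj x = X.
Proof.
have := fsvalP X; rewrite in_fset_set ?inE; last exact: pg_finite_vquot.
by move=> -[x _ xX]; exists x; apply/val_inj.
Qed.

(* A representative of an orbit of edges; the functions induced on the quotient
   do not depend on it, see [qsrcE], [qtgtE], [qinvE], [qtauE]. *)
Definition erepr (E : qedge) : oedge G := sval (cid (eproj_surj E)).

Definition qsrc (E : qedge) : qvertex := vproj (src (erepr E)).
Definition qtgt (E : qedge) : qvertex := vproj (tgt (erepr E)).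
Definition qinv (E : qedge) : qedge := eproj (inv (erepr E)).
Definition qtau (E : qedge) : 'rV[int]_d := etau (erepr E).

Lemma ereprK E : eproj (erepr E) = E.
Proof. by rewrite /erepr; case: cid. Qed.

Lemma erepr_eproj e : exists m, erepr (eproj e) = eshift m e.
Proof. by apply/eproj_eq; rewrite ereprK. Qed.

Lemma qsrcE e : qsrc (eproj e) = vproj (src e).
Proof.
apply/esym/vproj_eq; have [m ->] := erepr_eproj e.
by exists m; rewrite src_eshift.
Qed.

Lemma qtgtE e : qtgt (eproj e) = vproj (tgt e).
Proof.
apply/esym/vproj_eq; have [m ->] := erepr_eproj e.
by exists m; rewrite tgt_eshift.
Qed.

Lemma qinvE e : qinv (eproj e) = eproj (inv e).
Proof.
apply/esym/eproj_eq; have [m ->] := erepr_eproj e.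
by exists m; rewrite inv_eshift.
Qed.

Lemma qtauE e : qtau (eproj e) = etau e.
Proof. by rewrite /qtau; have [m ->] := erepr_eproj e; rewrite etau_eshift. Qed.

Lemma qinv_involutive E : qinv (qinv E) = E.
Proof. by have [e <-] := eproj_surj E; rewrite !qinvE inv_involutive. Qed.

Lemma qinv_neq E : qinv E <> E.
Proof.
have [e <-] := eproj_surj E; rewrite qinvE => /eproj_eq[m em].
have em2 : e = eshift (m + m) e.
  have := congr1 (@inv G) em; rewrite inv_eshift inv_involutive => ime.
  by rewrite eshiftD -ime.
have : ivec R (m + m) *m basis G = 0.
  apply: (addrI (pos (src e))).
  by rewrite addr0 -pos_vshift -src_eshift -em2.
move/(congr1 (mulmx^~ (invmx (basis G)))).
rewrite mulmxK ?basis_unit// mul0mx => /rowP mm0.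
have m0 : m = 0.
  apply/rowP => s; have := mm0 s; rewrite !mxE => /eqP.
  by rewrite intr_eq0 -mulr2n mulrn_eq0/= => /eqP.
by apply: (@inv_neq _ e); rewrite [RHS]em m0 eshift0.
Qed.

Lemma qsrc_inv E : qsrc (qinv E) = qtgt E.
Proof. by have [e <-] := eproj_surj E; rewrite qinvE qsrcE qtgtE src_inv. Qed.

Definition fundamental_graph : graph := @Graph qvertex qedge qsrc qtgt qinv
  qinv_involutive qinv_neq qsrc_inv.

Definition tau_plus : R := \big[Num.max/0]_(E : qedge) enorm (ivec R (qtau E)).

Definition cycles (n : nat) : {set n.-tuple qedge} :=
  [set c : n.-tuple qedge | cycle (fun E F => qtgt E == qsrc F) c].

Definition cycle_index (c : seq qedge) : 'rV[int]_d := \sum_(E <- c) qtau E.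

Definition cycles_index (n : nat) m : {set n.-tuple qedge} :=
  [set c in cycles n | cycle_index c == m].

Definition ncycles (n : nat) : nat := #|cycles n|.

Definition ncycles_index (n : nat) m : nat := #|cycles_index n m|.

Definition nu : nat := #|qvertex|.

Definition fiber_op (k : 'rV[R]_d) (f : {ffun qvertex -> R[i]}) :
    {ffun qvertex -> R[i]} :=
  [ffun x => \sum_(E : qedge | qsrc E == x)
     expi (inner (ivec R (qtau E)) k) * f (qtgt E)].

(* The matrix of [fiber_op k] in the standard basis of l^2(V_* ), with the
   vertices of the fundamental graph numbered by [enum_val]. *)
Definition fiber_adj (k : 'rV[R]_d) : 'M[R[i]]_nu :=
  \matrix_(i, j) fiber_op k [ffun y => (y == enum_val j)%:R] (enum_val i).

Lemma fiber_adjE k (f : {ffun qvertex -> R[i]}) (i : 'I_nu) :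
  fiber_op k f (enum_val i) = \sum_j fiber_adj k i j * f (enum_val j).
Proof.
rewrite ffunE.
under [RHS]eq_bigr => j _ do rewrite mxE ffunE big_distrl/=.
rewrite exchange_big/=; apply: eq_bigr => E _.
rewrite (bigD1 (enum_rank (qtgt E)))//= ffunE enum_rankK eqxx mulr1 big1 ?addr0//.
move=> j jE; rewrite ffunE; case: eqP => [Ej|_]; last by rewrite mulr0 mul0r.
by rewrite Ej enum_valK eqxx in jE.
Qed.

Definition fiber_trace (n : nat) (k : 'rV[R]_d) : R[i] :=
  \tr (fiber_adj k ^+ n).

End Periodic.

Definition eigenvalues_of (C : closedFieldType) (n : nat) (A : 'M[C]_n)
    (lam : 'I_n -> C) : Prop :=
  char_poly A = \prod_j ('X - (lam j)%:P).

Lemma eigenvalues_exist (C : closedFieldType) (n : nat) (A : 'M[C]_n) :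
  exists lam, eigenvalues_of A lam.
Proof.
have [r rE] := closed_field_poly_normal (char_poly A).
rewrite (monicP (char_poly_monic A)) scale1r in rE.
have sr : size r = n.
  by apply/eqP; rewrite -eqSS -(size_prod_XsubC r id) -rE size_char_poly.
exists (fun j => r`_j); rewrite /eigenvalues_of rE (big_nth 0) big_mkord.
by rewrite sr.
Qed.

Section Lebesgue.
Variable R : realType.
Local Notation mR := (measurableTypeR R).

Section Step.
Variable n : nat.
Variable mu : {sigma_finite_measure set (n.-tuple mR) -> \bar R}.

Definition tcons (p : mR * n.-tuple mR) : n.+1.-tuple mR :=
  [the n.+1.-tuple mR of p.1 :: p.2].

Lemma measurable_tcons : measurable_fun setT tcons.
Proof. by apply: measurable_cons. Qed.

(* The product measure dx \x mu, transported from R * R^n to R^n.+1. *)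
Definition lebesgue_cons : set (n.+1.-tuple mR) -> \bar R :=
  pushforward (@lebesgue_measure R \x mu)%E tcons.

Let pm := measure_function_pushforward__canonical__measure_function_Measure
  (@lebesgue_measure R \x mu)%E measurable_tcons.

Let lebesgue_cons0 : lebesgue_cons set0 = 0%E.
Proof. exact: (@measure0 _ _ _ pm). Qed.

Let lebesgue_cons_ge0 A : (0 <= lebesgue_cons A)%E.
Proof. exact: (@measure_ge0 _ _ _ pm). Qed.

Let lebesgue_cons_sigma_additive : semi_sigma_additive lebesgue_cons.
Proof. exact: (@measure_semi_sigma_additive _ _ _ pm). Qed.

HB.instance Definition _ := isMeasure.Build _ _ _ lebesgue_cons
  lebesgue_cons0 lebesgue_cons_ge0 lebesgue_cons_sigma_additive.

Definition tuncons (t : n.+1.-tuple mR) : mR * n.-tuple mR :=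
  (tnth t ord0, [tuple of behead t]).

Lemma measurable_tuncons : measurable_fun setT tuncons.
Proof.
apply: measurable_fun_pair; first exact: measurable_tnth.
exact: measurable_behead.
Qed.

Lemma tconsK : cancel tcons tuncons.
Proof. by case=> x t; congr pair; apply/val_inj. Qed.

Let lebesgue_cons_sigma_finite : sigma_finite setT lebesgue_cons.
Proof.
have /sigma_finiteP[F [TF ndF Foo]] := sigma_finiteT (@lebesgue_measure R).
have /sigma_finiteP[H [TH ndH Hoo]] := sigma_finiteT mu.
exists (fun k => tuncons @^-1` (F k `*` H k)).
  rewrite -preimage_bigcup (_ : \bigcup_k _ = setT) ?preimage_setT//.
  apply/seteqP; split=> // -[x t] _.
  have [i _ Fx] : (\bigcup_k F k) x by rewrite -TF.
  have [j _ Ht] : (\bigcup_k H k) t by rewrite -TH.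
  exists (maxn i j) => //; split.
    by move: x Fx; exact/subsetPset/ndF/leq_maxl.
  by move: t Ht; exact/subsetPset/ndH/leq_maxr.
move=> k; have [mF Fk] := Foo k; have [mH Hk] := Hoo k.
have mFH : measurable (F k `*` H k) by exact: measurableX.
split.
  by rewrite -[X in measurable X]setTI; exact: measurable_tuncons.
rewrite /lebesgue_cons /pushforward -comp_preimage.
rewrite (_ : tuncons \o tcons = id) ?preimage_id//; last exact/funext/tconsK.
by rewrite product_measure1E// lte_mul_pinfty// ge0_fin_numE.
Qed.

HB.instance Definition _ := Measure_isSigmaFinite.Build _ _ _ lebesgue_cons
  lebesgue_cons_sigma_finite.

End Step.

Fixpoint lebesgue_measure_n (n : nat) :
    {sigma_finite_measure set (n.-tuple mR) -> \bar R} :=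
  match n return {sigma_finite_measure set (n.-tuple mR) -> \bar R} with
  | 0 => dirac [tuple]
  | n'.+1 => lebesgue_cons (lebesgue_measure_n n')
  end.

Lemma lebesgue_measure_n_box (n : nat) (A : 'I_n -> set mR) :
  (forall i, measurable (A i)) ->
  lebesgue_measure_n n [set t | forall i, A i (tnth t i)] =
  (\prod_(i < n) lebesgue_measure (A i))%E.
Proof.
elim: n A => [|n IHn] A mA /=.
  rewrite big_ord0 diracE mem_set//; by case.
have mbox : measurable [set t : n.-tuple mR | forall i, A (lift ord0 i) (tnth t i)].
  rewrite (_ : mkset _ =
    \bigcap_(i in [set: 'I_n]) ((@tnth _ _ ^~ i) @^-1` A (lift ord0 i))).
    apply: fin_bigcap_measurable => // i _.
    by rewrite -[X in measurable X]setTI; exact: measurable_tnth.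
  by apply/seteqP; split=> t /= H i; [move=> _|]; exact: H.
rewrite big_ord_recl /= -IHn// -product_measure1E//.
rewrite /lebesgue_cons /pushforward; congr (_ _).
apply/seteqP; split=> [[x t]/= H|[x t]/= [H0 H] i].
  split; first by have := H ord0; rewrite tnth0.
  by move=> i; have := H (lift ord0 i); rewrite tnthS.
by case: (unliftP ord0 i) => [j|] ->; rewrite ?tnthS ?tnth0.
Qed.

(* The cell [0, 2 pi[^n representing R^n / (2 pi Z)^n. *)
Definition torus_cell (n : nat) : set (n.-tuple mR) :=
  [set t | forall i, tnth t i \in `[0, 2 * pi[].

Arguments torus_cell : clear implicits.

Definition row_of_tuple (n : nat) (t : n.-tuple mR) : 'rV[R]_n :=
  \row_i tnth t i.

(* Real and imaginary parts are integrated separately. *)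
Definition torus_integral (n : nat) (f : 'rV[R]_n -> R[i]) : R[i] :=
  (\int[lebesgue_measure_n n]_(t in torus_cell n) complex.Re (f (row_of_tuple t)))
  +i*
  (\int[lebesgue_measure_n n]_(t in torus_cell n) complex.Im (f (row_of_tuple t))).

End Lebesgue.

(* Main.v *)
Require Import Defs.
From HB Require Import structures.
From mathcomp Require Import all_boot all_order all_algebra.
From mathcomp Require Import finmap.
From mathcomp Require Import complex.
From mathcomp Require Import all_classical all_reals all_analysis.
From mathcomp Require Import measurable_realfun zify ring lra.

(* Expanding the trace of a power of the fiber matrix gives a sum of
   exp(i <tau(c), k>) over the cycles c of length n; reversing a cycle negates its
   index, so only the cosines survive, and integration over the torus keeps only
   the cycles of index 0.  Those are the projections of the closed walks of the
   periodic graph.  Both bipartiteness criteria follow, since a connected graph is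
   bipartite exactly when it has no closed walk of odd length, and in a finite
   graph a shortest such walk does not repeat a vertex. *)

Set Implicit Arguments.
Unset Strict Implicit.
Unset Printing Implicit Defensive.

Import Order.TTheory GRing.Theory Num.Theory numFieldNormedType.Exports.

Local Open Scope classical_set_scope.
Local Open Scope ring_scope.
Local Open Scope complex_scope.

(** In (iv) no bound on [n] in terms of [nu] is possible: the integral sees closed walks of the
    infinite graph, where the shortest odd one may be arbitrarily long. The graphs that show this
    have a single orbit of vertices, so [nu] is 1 and every edge of the quotient is a loop, while an
    odd closed walk of the periodic graph must compensate a long edge by many unit edges. The
    eigenvalues are an arbitrary listing of the roots of the characteristic polynomial, so the trace
    identity compares multisets after passing to a triangular form. Lebesgue measure on tuples is
    built one coordinate at a time, so orthogonality of the characters is an induction on the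
    dimension; the cosine of a sum does not factor, and the induction therefore carries an arbitrary
    phase. *)

(** * Parity of closed walks and bipartiteness *)

Section Walks.
Variable G : graph.
Implicit Types (x y z : vertex G) (e : oedge G) (p q : seq (oedge G)).

Lemma tgt_inv e : tgt (Defs.inv e) = src e.
Proof. by rewrite -src_inv inv_involutive. Qed.

Lemma walk_cat x y z p q : walk x p y -> walk y q z -> walk x (p ++ q) z.
Proof.
by elim: p x => [|e p IHp] x /= => [->//|[<- /IHp pq] /pq].
Qed.

Lemma walk_cat_inv x z p q :
  walk x (p ++ q) z -> exists2 y, walk x p y & walk y q z.
Proof.
elim: p x => [|e p IHp] x /=; first by exists x.
by case=> <- /IHp[y py qz]; exists y.
Qed.

Lemma walk_rev x y p : walk x p y -> walk y (rev (map (@Defs.inv G) p)) x.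
Proof.
elim: p x => [|e p IHp] x /= => [->//|[<- /IHp pw]].
rewrite rev_cons -cats1; apply: walk_cat pw _ => /=.
by rewrite src_inv tgt_inv.
Qed.

Lemma bipartite_walk (V1 V2 : set (vertex G)) x y p :
  V1 `&` V2 = set0 ->
  (forall e, (V1 (src e) /\ V2 (tgt e)) \/ (V2 (src e) /\ V1 (tgt e))) ->
  walk x p y -> (V1 x -> if odd (size p) then V2 y else V1 y) /\
                (V2 x -> if odd (size p) then V1 y else V2 y).
Proof.
move=> V12 Ve; have V12F u : V1 u -> V2 u -> False.
  by move=> V1u V2u; suff : set0 u by []; rewrite -V12.
elim: p x => [|e p IHp] x /=; first by move=> ->.
move=> [<- /IHp[IH1 IH2]].
case: (Ve e) => -[s t]; split=> s'; try by case: (V12F (src e)).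
- by have := IH2 t; case: odd.
- by have := IH1 t; case: odd.
Qed.

Lemma bipartite_closed_walk x p : bipartite G -> walk x p x -> ~~ odd (size p).
Proof.
move=> [V1 [V2 [V12T V12 Ve]]] /(bipartite_walk V12 Ve)[H1 H2].
apply/negP => op; rewrite op in H1 H2.
suff : set0 x by [].
rewrite -V12; have : (V1 `|` V2) x by rewrite V12T.
by case=> [|] Vx; split=> //; [exact: H1|exact: H2].
Qed.

(** Colour each vertex by the parity of a walk from a base point. Parity is well defined because one
    walk followed by the reverse of another is closed, hence even. *)
Lemma even_closed_walks_bipartite : connected_graph G ->
  (forall x p, walk x p x -> ~~ odd (size p)) -> bipartite G.
Proof.
move=> conn evenG.
(* The empty graph counts as connected and has no base point. *)
have [[x0 _]|noV] := pselect (exists x0 : vertex G, True); last first.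
  exists setT, set0; split; rewrite ?setU0 ?setI0// => e.
  by case: noV; exists (src e).
pose V1 : set (vertex G) := [set y | exists2 p, walk x0 p y & ~~ odd (size p)].
exists V1, (~` V1); rewrite setUv setICr; split=> // e.
have we : walk (src e) [:: e] (tgt e) by [].
have [[p pw ep]|V1s] := pselect (V1 (src e)).
  left; split; first by exists p.
  move=> [q qw eq].
  have := evenG _ _ (walk_cat (walk_cat pw we) (walk_rev qw)).
  by rewrite !size_cat size_rev size_map !oddD (negbTE ep) (negbTE eq).
(* Every walk to [src e] is odd here, so one more edge gives an even walk to [tgt e]. *)
right; split=> //; have [p pw] := conn x0 (src e).
exists (p ++ [:: e]); first exact: walk_cat pw we.
rewrite size_cat oddD /= addbT negbK.
by apply: contrapT => /negP ep; apply: V1s; exists p.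
Qed.

Lemma bipartiteP : connected_graph G ->
  (bipartite G <-> forall x p, walk x p x -> ~~ odd (size p)).
Proof.
move=> conn; split; first by move=> bG x p; exact: bipartite_closed_walk.
exact: even_closed_walks_bipartite.
Qed.

End Walks.

(* A closed walk longer than the number of vertices visits some vertex twice,
   hence splits into two shorter closed walks, one of which is odd. *)
Lemma short_odd_closed_walk (V : finType) (G : graph) (f : vertex G -> V) :
  injective f -> forall (x : vertex G) p, walk x p x -> odd (size p) ->
  exists (y : vertex G) q, [/\ walk y q y, odd (size q) & (size q <= #|V|)%N].
Proof.
move=> f_inj x p; have [n] := ubnP (size p).
elim: n x p => // n IHn x p; rewrite ltnS => pn pw op.
have [|lt_p] := leqP (size p) #|V|; first by exists x, p.
have : ~~ uniq (map (f \o @src G) p).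
  apply/negP => /card_uniqP; rewrite size_map => card_p.
  by have := max_card (mem (map (f \o @src G) p)); rewrite card_p leqNgt lt_p.
case: p pn pw op lt_p => // e0 p' pn pw op lt_p.
set p := e0 :: p' in pn pw op lt_p *.
move=> /(uniqPn (f x)) [i [j [ij]]]; rewrite size_map => jp.
have ip := ltn_trans ij jp.
rewrite !(nth_map e0)// => /f_inj sij.
have nthP k z (kp : (k < size p)%N) :
    walk z (drop k p) x -> z = src (nth e0 p k).
  by rewrite (drop_nth e0)//= => -[->].
have : p = take i p ++ take (j - i) (drop i p) ++ drop j p.
  by rewrite -{2}(subnK (ltnW ij)) -drop_drop cat_take_drop cat_take_drop.
set p1 := take i p; set p2 := take _ _; set p3 := drop j p => pE.
have size_p : (size p = size p1 + size p2 + size p3)%N.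
  by rewrite {1}pE !size_cat addnA.
have p2E : size p2 = (j - i)%N.
  by rewrite size_take size_drop; case: ltnP => //; lia.
have := pw; rewrite pE => /walk_cat_inv[y p1w].
move=> p23w; have yi : y = src (nth e0 p i).
  apply: nthP => //; move: p23w.
  by rewrite /p2 /p3 -{2}(subnK (ltnW ij)) -drop_drop cat_take_drop.
move: p23w => /walk_cat_inv[z p2w p3w].
have zj : z = src (nth e0 p j) by exact: nthP.
have yz : z = y by rewrite yi zj.
rewrite {}yz in p2w p3w.
(* If the loop [p2] is odd, it is shorter than [p] because [p3] still contains the edge at position
   [j]; otherwise cutting [p2] out keeps the parity and shortens [p] by [j - i]. *)
have [odd2|even2] := boolP (odd (size p2)).
  apply: (IHn y p2) => //; rewrite (leq_trans _ pn)// size_p.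
  have : (0 < size p3)%N by rewrite size_drop subn_gt0.
  by lia.
apply: (IHn x (p1 ++ p3)) => //; rewrite ?size_cat.
- by rewrite (leq_trans _ pn)// size_p p2E; lia.
- exact: walk_cat p1w p3w.
- by move: op; rewrite size_p !oddD (negbTE even2) addbF.
Qed.


(** * Traces of powers and eigenvalues *)

Lemma expr_trig_mx (K : comNzRingType) (m n : nat) (T : 'M[K]_m) :
  is_trig_mx T -> is_trig_mx (T ^+ n) /\ forall i, (T ^+ n) i i = T i i ^+ n.
Proof.
move=> /is_trig_mxP trigT; elim: n => [|n [/is_trig_mxP trigTn IHn]].
  split; first exact: scalar_mx_is_trig.
  by move=> i; rewrite mxE eqxx.
rewrite exprS; split.
  apply/is_trig_mxP => i j ij; rewrite mxE big1// => l _.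
  have [il|li] := ltnP i l; first by rewrite trigT// mul0r.
  by rewrite trigTn ?mulr0// (leq_ltn_trans li).
move=> i; rewrite mxE (bigD1 i)//= IHn big1 ?addr0 ?exprS// => l li.
have [il|il|/val_inj il] := ltngtP i l; first by rewrite trigT// mul0r.
  by rewrite trigTn ?mulr0.
by rewrite il eqxx in li.
Qed.

(** Schur's theorem makes [A] similar to a triangular [T], which shares its characteristic
    polynomial and the traces of its powers. Unique factorisation then identifies the diagonal of
    [T] with [lam] up to order. *)
Lemma mxtrace_exp_eigenvalues (C : numClosedFieldType) (m n : nat)
    (A : 'M[C]_m) (lam : 'I_m -> C) :
  eigenvalues_of A lam -> \tr (A ^+ n) = \sum_j lam j ^+ n.
Proof.
have [m0|m_gt0] := posnP m.
  by move: A lam; rewrite m0 => A lam _; rewrite /mxtrace !big_ord0.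
have [P /unitarymx_unit Pu trigPA] := Schur A m_gt0.
set T := conjmx P A in trigPA.
have PAT : P *m A = T *m P by rewrite /T conjumx ?mulmxKV.
have PAnT k : P *m A ^+ k = T ^+ k *m P.
  elim: k => [|k IHk]; first by rewrite !expr0 mul1mx mulmx1.
  by rewrite exprSr [LHS]mulmxA IHk -mulmxA PAT mulmxA -[_ *m T]exprSr.
have AE k : A ^+ k = invmx P *m T ^+ k *m P.
  by rewrite -mulmxA -PAnT mulKmx.
have -> : \tr (A ^+ n) = \tr (T ^+ n).
  by rewrite AE mxtrace_mulC mulmxA mulmxV// mul1mx.
have -> : \tr (T ^+ n) = \sum_j T j j ^+ n.
  by apply: eq_bigr => i _; have [_ ->] := expr_trig_mx n trigPA.
rewrite /eigenvalues_of => charA.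
have charT : char_poly T = char_poly A.
  (* The similarity is carried over to polynomial matrices without inverting there: [det P'] is a
     nonzero constant and cancels. *)
  pose P' := map_mx (polyC : C -> {poly C}) P.
  have P'AT : P' *m char_poly_mx A = char_poly_mx T *m P'.
    rewrite /char_poly_mx mulmxBr mulmxBl -!map_mxM PAT.
    by rewrite mul_scalar_mx mul_mx_scalar.
  have P'0 : \det P' != 0 by rewrite det_map_mx polyC_eq0 -unitfE -unitmxE.
  by apply: (mulIf P'0); rewrite -det_mulmx -P'AT det_mulmx mulrC.
rewrite charA char_poly_trig// in charT.
have perm_lam : perm_eq [seq T j j | j : 'I_m] [seq lam j | j : 'I_m].
  by apply: prod_XsubC_eq; rewrite !big_image.
have : \sum_(x <- [seq T j j | j : 'I_m]) x ^+ n =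
       \sum_(x <- [seq lam j | j : 'I_m]) x ^+ n by exact: perm_big.
by rewrite !big_image.
Qed.

(** * Powers of a weighted adjacency matrix as sums over walks *)

Section TransferMatrix.
Variables (K : comNzRingType) (V E : finType) (s t : E -> V) (z : E -> K).

Definition transfer_mx : 'M[K]_#|V| :=
  \matrix_(i, j) \sum_(e | s e == enum_val i) z e * (t e == enum_val j)%:R.

(** The Boolean form of [walk], so that it can serve as a summation predicate. *)
Fixpoint bwalk (x : V) (c : seq E) (y : V) : bool :=
  if c is e :: c' then (s e == x) && bwalk (t e) c' y else x == y.

Lemma big_tuple_cons (n : nat) (P : pred (n.+1.-tuple E)) (F : n.+1.-tuple E -> K) :
  \sum_(c | P c) F c =
  \sum_e \sum_(c : n.-tuple E | P [tuple of e :: c]) F [tuple of e :: c].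
Proof.
rewrite pair_big_dep /=.
rewrite (reindex (fun p : E * n.-tuple E => [tuple of p.1 :: p.2])) /=.
  by apply: eq_bigl => -[].
exists (fun c => (thead c, [tuple of behead c])) => [[e c] _|c _] /=.
  by congr pair; apply/val_inj.
by rewrite [RHS]tuple_eta.
Qed.

Lemma transfer_mx_exp (n : nat) i j :
  (transfer_mx ^+ n) i j =
  \sum_(c : n.-tuple E | bwalk (enum_val i) c (enum_val j)) \prod_(e <- c) z e.
Proof.
elim: n i => [|n IHn] i.
  rewrite expr0 mxE.
  transitivity (\sum_(c : 0.-tuple E) (i == j)%:R : K).
    by rewrite big_const card_tuple expn0 /= addr0.
  rewrite [RHS]big_mkcond; apply: eq_bigr => c _.
  by rewrite tuple0 /= big_nil (inj_eq enum_val_inj); case: eqP.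
rewrite exprS mxE big_tuple_cons.
transitivity (\sum_(e | s e == enum_val i) \sum_(c : n.-tuple E |
    bwalk (t e) c (enum_val j)) z e * \prod_(e <- c) z e).
  under eq_bigr => l _ do rewrite mxE IHn big_distrl.
  rewrite exchange_big; apply: eq_bigr => e _ /=.
  rewrite (bigD1 (enum_rank (t e)))//= enum_rankK eqxx mulr1 -big_distrr/=.
  rewrite [X in _ + X]big1 ?addr0// => l le.
  case: eqP => [te|_]; last by rewrite mulr0 mul0r.
  by rewrite te enum_valK eqxx in le.
rewrite [LHS]big_mkcond; apply: eq_bigr => e _ /=.
under [RHS]eq_bigr do rewrite big_cons.
by case: eqP => _ //=; rewrite big_pred0.
Qed.

Lemma bwalk_path x e c y :
  bwalk x (e :: c) y =
  [&& s e == x, path (fun e f => t e == s f) e c & t (last e c) == y].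
Proof.
rewrite /=; congr (_ && _).
elim: c e => [|f c IHc] e //=.
by rewrite IHc eq_sym andbA.
Qed.

Lemma bwalk_cycle e c :
  cycle (fun e f => t e == s f) (e :: c) = bwalk (s e) (e :: c) (s e).
Proof. by rewrite bwalk_path eqxx /= rcons_path. Qed.

(** A nonempty cycle fixes its diagonal entry, the source of its first edge. For [n = 0] the trace
    is the number of vertices, whereas there is only one empty tuple. *)
Lemma mxtrace_transfer_exp (n : nat) : (0 < n)%N ->
  \tr (transfer_mx ^+ n) =
  \sum_(c : n.-tuple E | cycle (fun e f => t e == s f) c) \prod_(e <- c) z e.
Proof.
case: n => // n _; rewrite /mxtrace.
under eq_bigr do rewrite transfer_mx_exp.
rewrite (exchange_big_dep xpredT)//= [RHS]big_mkcond; apply: eq_bigr => c _.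
case/tupleP: c => e c; rewrite -[cycle _ _]/(cycle _ (e :: c)) bwalk_cycle.
case: ifPn => [wc|nwc].
  rewrite (bigD1 (enum_rank (s e))) /=; last first.
    by rewrite -/(bwalk _ _ _) enum_rankK.
  rewrite [X in _ + X]big1 ?addr0// => i /andP[/andP[/eqP si _]].
  by rewrite si enum_valK eqxx.
rewrite big_pred0// => i; apply/negbTE/negP => /= /andP[/eqP si wc].
by move: nwc; rewrite /= eqxx si wc.
Qed.

End TransferMatrix.

(** * Characters and the Euclidean norm *)

Section CharacterSums.
Variables (R : realType) (d : nat).
Implicit Types (u v k : 'rV[R]_d) (m : 'rV[int]_d).

Lemma innerDl u v k : inner (u + v) k = inner u k + inner v k.
Proof. by rewrite -big_split; apply: eq_bigr => s _; rewrite mxE mulrDl. Qed.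

Lemma innerNl u k : inner (- u) k = - inner u k.
Proof. by rewrite -sumrN; apply: eq_bigr => s _; rewrite mxE mulNr. Qed.

Lemma inner0l k : inner 0 k = 0.
Proof. by rewrite /inner big1// => s _; rewrite mxE mul0r. Qed.

Lemma inner0r u : inner u 0 = 0.
Proof. by rewrite /inner big1// => s _; rewrite mxE mulr0. Qed.

Lemma inner_sum (I : Type) (r : seq I) (f : I -> 'rV[R]_d) k :
  inner (\sum_(i <- r) f i) k = \sum_(i <- r) inner (f i) k.
Proof.
elim: r => [|i r IHr]; first by rewrite !big_nil inner0l.
by rewrite !big_cons innerDl IHr.
Qed.

Lemma innerC u v : inner u v = inner v u.
Proof. by apply: eq_bigr => s _; rewrite mulrC. Qed.

Lemma ivecN m : ivec R (- m) = - ivec R m.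
Proof. by rewrite /ivec raddfN. Qed.

Lemma ivec_sum (I : Type) (r : seq I) (f : I -> 'rV[int]_d) :
  ivec R (\sum_(i <- r) f i) = \sum_(i <- r) ivec R (f i).
Proof. by rewrite /ivec raddf_sum. Qed.

Lemma expi0 : expi (0 : R) = 1.
Proof. by rewrite /expi cos0 sin0. Qed.

Lemma expiD (a b : R) : expi (a + b) = expi a * expi b.
Proof. by rewrite /expi cosD sinD; simpc; rewrite [X in _ +i* X]addrC. Qed.

Lemma sum_complex (I : Type) (r : seq I) (P : pred I) (a b : I -> R) :
  \sum_(i <- r | P i) (a i +i* b i) =
  (\sum_(i <- r | P i) a i) +i* (\sum_(i <- r | P i) b i).
Proof. by elim/big_rec3: _ => // i z y x _ ->; simpc. Qed.

(** Squaring the norm of the sum leaves [n ^ 2] inner products, each at most [b ^ 2]. *)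
Lemma enorm_sum_le (n : nat) (w : 'I_n -> 'rV[R]_d) (b : R) :
  (forall i, enorm (w i) <= b) -> enorm (\sum_i w i) <= n%:R * b.
Proof.
move=> wb; case: n => [|n] in w wb *.
  by rewrite big_ord0 mul0r /enorm inner0l sqrtr0.
have inner_ge0 u : 0 <= inner u u.
  by apply: sumr_ge0 => s _; rewrite -expr2 sqr_ge0.
have b0 : 0 <= b by apply: le_trans (wb ord0); exact: sqrtr_ge0.
rewrite -(ger0_norm (mulr_ge0 (ler0n _ n.+1) b0)) -sqrtr_sqr ler_wsqrtr//.
have wwb i j : inner (w i) (w j) <= b ^+ 2.
  have sq l : inner (w l) (w l) <= b ^+ 2.
    rewrite -(sqr_sqrtr (inner_ge0 (w l))); apply: lerXn2r; rewrite ?nnegrE ?sqrtr_ge0//.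
    exact: wb.
  (* Twice the mixed product is at most the sum of the two squares. *)
  have := inner_ge0 (w i - w j).
  rewrite innerDl innerNl ![inner _ (w i - w j)]innerC !innerDl !innerNl.
  rewrite (innerC (w j) (w i)).
  by move: (sq i) (sq j); lra.
rewrite inner_sum; under eq_bigr do rewrite innerC inner_sum.
apply: (@le_trans _ _ (\sum_(i < n.+1) \sum_(j < n.+1) b ^+ 2)).
  by apply: ler_sum => i _; apply: ler_sum => j _; exact: wwb.
by rewrite !sumr_const !card_ord -mulrnA -[leLHS]mulr_natl natrM exprMn expr2.
Qed.

End CharacterSums.

(** * The fiber trace as a sum over cycles *)

Section FundamentalGraph.
Variables (R : realType) (d : nat) (G : periodic_graph R d).
Implicit Types (E F : qedge G) (k : 'rV[R]_d) (m : 'rV[int]_d).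

Lemma qtgt_inv E : qtgt (qinv E) = qsrc E.
Proof. by rewrite -qsrc_inv qinv_involutive. Qed.

Lemma qtau_inv E : qtau (qinv E) = - qtau E.
Proof.
by have [e <-] := eproj_surj E; rewrite qinvE !qtauE /etau src_inv tgt_inv opprB.
Qed.

Definition rev_cyc (n : nat) (c : n.-tuple (qedge G)) : n.-tuple (qedge G) :=
  [tuple of rev (map (@qinv R d G) c)].

Lemma rev_cycK n : involutive (@rev_cyc n).
Proof.
move=> c; apply/val_inj => /=; rewrite map_rev revK -map_comp.
by rewrite map_id_in// => E _ /=; rewrite qinv_involutive.
Qed.

Lemma rev_cyc_cycles n (c : n.-tuple (qedge G)) :
  (rev_cyc c \in cycles G n) = (c \in cycles G n).
Proof.
rewrite !inE /= rev_cycle cycle_map; apply: eq_cycle => E F /=.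
by rewrite qtgt_inv qsrc_inv eq_sym.
Qed.

Lemma cycle_index_rev n (c : n.-tuple (qedge G)) :
  cycle_index (rev_cyc c) = - cycle_index c.
Proof.
rewrite /cycle_index -sumrN /= -[RHS]/(\sum_(E <- c) - qtau E).
transitivity (\sum_(E <- map (@qinv R d G) c) qtau E).
  by apply: perm_big; rewrite perm_rev.
by rewrite big_map; apply: eq_bigr => E _; rewrite qtau_inv.
Qed.

Lemma fiber_adj_transfer k : fiber_adj G k =
  transfer_mx (@qsrc R d G) (@qtgt R d G)
    (fun E => expi (inner (ivec R (qtau E)) k)).
Proof.
apply/matrixP => i j; rewrite !mxE ffunE; apply: eq_bigr => E _.
by rewrite ffunE.
Qed.

Lemma fiber_trace_expi n k : (0 < n)%N ->
  fiber_trace G n k =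
  \sum_(c in cycles G n) expi (inner (ivec R (cycle_index c)) k).
Proof.
move=> n0; rewrite /fiber_trace fiber_adj_transfer mxtrace_transfer_exp//.
apply: eq_big => [c|c _]; first by rewrite inE.
rewrite /cycle_index ivec_sum inner_sum.
elim: (tval c) => [|E s IHs]; first by rewrite !big_nil expi0.
by rewrite !big_cons expiD IHs.
Qed.

(* Reversing a cycle negates its index, so the sines cancel. *)
Lemma fiber_trace_cos n k : (0 < n)%N ->
  fiber_trace G n k =
  (\sum_(c in cycles G n) cos (inner (ivec R (cycle_index c)) k))%:C.
Proof.
move=> n0; rewrite fiber_trace_expi//.
have sin0 : \sum_(c in cycles G n) sin (inner (ivec R (cycle_index c)) k) = 0.
  set S := LHS; suff : S = - S by lra.
  rewrite {1}/S (reindex_inj (inv_inj (@rev_cycK n))) /= -sumrN.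
  apply: eq_big => c; first exact: rev_cyc_cycles.
  by rewrite cycle_index_rev ivecN innerNl sinN.
by rewrite -[RHS]/(_ +i* 0) -[X in _ +i* X]sin0 -sum_complex.
Qed.

Lemma cos_cycle_sum_le n k :
  `|\sum_(c in cycles G n) cos (inner (ivec R (cycle_index c)) k)| <=
  (ncycles G n)%:R.
Proof.
apply: le_trans (ler_norm_sum _ _ _) _.
rewrite /ncycles -sum1_card natr_sum; apply: ler_sum => c _.
by rewrite ler_norml cos_geN1 cos_le1.
Qed.

Lemma fiber_trace0 n : (0 < n)%N -> fiber_trace G n 0 = (ncycles G n)%:R.
Proof.
move=> n0; rewrite fiber_trace_cos// /ncycles -sum1_card natr_sum rmorph_sum /=.
by apply: eq_bigr => c _; rewrite inner0r cos0.
Qed.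

Lemma norm_fiber_trace_le n k : (0 < n)%N ->
  `|fiber_trace G n k| <= fiber_trace G n 0.
Proof.
move=> n0; rewrite fiber_trace0// fiber_trace_cos// normc_def /=.
rewrite expr0n /= addr0 sqrtr_sqr -[X in _ <= X](rmorph_nat (real_complex R)).
by rewrite lecR cos_cycle_sum_le.
Qed.

Lemma enorm_cycle_index_le n (c : n.-tuple (qedge G)) :
  enorm (ivec R (cycle_index c)) <= n%:R * tau_plus G.
Proof.
rewrite /cycle_index ivec_sum big_tuple; apply: enorm_sum_le => i.
exact: le_bigmax.
Qed.

(** The sum over the ball reduces to the list [idx] of indices that cycles attain: these lie in the
    ball, and all other counts vanish. After exchanging the sums, each cycle meets exactly one entry
    of [idx]. *)
Lemma sum_cycles_by_index n (f : 'rV[int]_d -> R) :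
  \sum_(m \in [set m : 'rV[int]_d | enorm (ivec R m) <= n%:R * tau_plus G])
     (ncycles_index G n m)%:R * f m =
  \sum_(c in cycles G n) f (cycle_index c).
Proof.
pose idx := undup [seq cycle_index c | c : n.-tuple (qedge G) in cycles G n].
pose A := [set m : 'rV[int]_d | enorm (ivec R m) <= n%:R * tau_plus G].
have idxA m : m \in idx -> A m.
  rewrite mem_undup => /fintype.imageP[c _ ->]; exact: enorm_cycle_index_le.
rewrite (@fsbigE _ _ _ _ _ idx) ?undup_uniq//; last first.
  move=> m _; rewrite mem_undup => mNidx.
  rewrite (_ : ncycles_index G n m = 0%N) ?mul0r//; apply: eq_card0 => c.
  rewrite inE; apply/negP => /andP[cC /eqP cm].
  by case/negP: mNidx; apply/fintype.imageP; exists c.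
rewrite big_seq_cond; under eq_bigl => m.
  rewrite (_ : _ && _ = (m \in idx)); last first.
    by apply: andb_idr => /idxA ?; rewrite inE.
  over.
rewrite -big_seq.
under eq_bigr => m _.
  rewrite /ncycles_index -sum1_card natr_sum mulr_suml.
  under eq_bigl do rewrite inE.
  rewrite big_mkcondr /=.
  over.
rewrite exchange_big /=; apply: eq_bigr => c cC.
rewrite -big_mkcond (big_rem (cycle_index c)) /=; last first.
  by rewrite mem_undup; apply/fintype.imageP; exists c.
rewrite eqxx mul1r big1_seq ?addr0// => m /andP[/eqP cm].
by rewrite -cm mem_rem_uniqF// undup_uniq.
Qed.

End FundamentalGraph.

(** * Integration of characters over the torus *)

(** Fubini on a rectangle, obtained from the whole product by extending [f] by zero. *)
Lemma integral_setX (d1 d2 : measure_display) (T1 : measurableType d1)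
    (T2 : measurableType d2) (R : realType)
    (m1 : {sigma_finite_measure set T1 -> \bar R})
    (m2 : {sigma_finite_measure set T2 -> \bar R})
    (A : set T1) (B : set T2) (f : T1 * T2 -> \bar R) :
  measurable A -> measurable B -> (m1 \x m2)%E.-integrable (A `*` B) f ->
  (\int[m1 \x m2]_(z in A `*` B) f z =
   \int[m1]_(x in A) \int[m2]_(y in B) f (x, y))%E.
Proof.
move=> mA mB intf; rewrite integral_mkcond -integral12_prod_meas1; last first.
  by apply/(integrable_mkcond _ (measurableX mA mB)).
rewrite [RHS]integral_mkcond; apply: eq_integral => x _.
rewrite /fubini_F patchE; case: ifPn => xA.
  rewrite [RHS]integral_mkcond; apply: eq_integral => y _.
  by rewrite !patchE in_setX xA.
by rewrite integral0_eq// => y _; rewrite patchE in_setX (negbTE xA).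
Qed.

Section TorusIntegral.
Variable R : realType.
Local Notation mR := (measurableTypeR R).

Lemma sinD2pi_int (a : int) (x : R) : sin (x + a%:~R * (2 * pi)) = sin x.
Proof.
have nat_case (n : nat) (y : R) : sin (y + n%:R * (2 * pi)) = sin y.
  by rewrite [2 * pi]mulr_natl mulr_natl (periodicn (@sinD2pi R)).
case: a => n; first by rewrite -pmulrn nat_case.
by rewrite -(nat_case n.+1) -addrA NegzE mulrNz -pmulrn -mulrDl addNr mul0r addr0.
Qed.

Lemma integral_cos_affine (a : int) (theta : R) :
  (\int[lebesgue_measure]_(x in `[0%R, (2 * pi)%R[)
     (cos (theta + a%:~R * x))%:E =
   ((a == 0)%:R * (2 * pi * cos theta))%:E)%E.
Proof.
have pi2 : (0 : R) < 2 * pi by rewrite mulr_gt0// pi_gt0.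
have [->|a0] := eqVneq a 0.
  under eq_integral do rewrite mul0r addr0.
  rewrite mul1r integral_cst//= lebesgue_measure_itv/= lte_fin pi2.
  by rewrite -EFinB subr0 -EFinM mulrC.
have a0R : a%:~R != 0 :> R by rewrite intr_eq0.
have cont_phase : continuous (fun x : R => theta + a%:~R * x).
  move=> x; apply: continuousD; first exact: cst_continuous.
  by apply: continuousM; [exact: cst_continuous|exact: cvg_id].
have cont_cos : continuous (fun x : R => cos (theta + a%:~R * x)).
  by move=> x; apply: continuous_comp; [exact: cont_phase|exact: continuous_cos].
(* For [a] nonzero this antiderivative takes the same value at both ends of the period. *)
pose F (x : R) := (a%:~R)^-1 * sin (theta + a%:~R * x).
have dF (x : R) : is_derive x 1 F (cos (theta + a%:~R * x)).
  have dphase : is_derive x 1 (fun y : R => theta + a%:~R * y) a%:~R.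
    by apply: is_derive_eq; rewrite add0r mul1r; exact: mulr1.
  have := @is_derive1_comp _ sin _ _ _ _ (is_derive_sin _) dphase.
  move=> dsin; apply: (is_derive_eq (is_deriveZ (a%:~R)^-1 dsin)).
  by rewrite [LHS]mulrC mulfK.
have cont_F : continuous F.
  move=> x; apply/differentiable_continuous/derivable1_diffP.
  by case: (dF x).
(* The fundamental theorem of calculus is applied on the closed interval; the added endpoint is a
   null set. *)
rewrite integral_itv_bndo_bndc; last first.
  apply/measurable_EFinP/measurable_funTS.
  exact: continuous_measurable_fun.
rewrite (@continuous_FTC2 _ _ F)//.
- rewrite mul0r -EFinB /F -mulrBr.
  by rewrite sinD2pi_int mulr0 addr0 subrr mulr0.
- exact: continuous_subspaceT.
- split.
  + by move=> x _; case: (dF x).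
  + exact/cvg_at_right_filter/cont_F.
  + exact/cvg_at_left_filter/cont_F.
- by move=> x _; rewrite derive1E; apply: derive_val.
Qed.

Lemma measurable_torus_cell n : measurable (@torus_cell R n).
Proof.
rewrite (_ : @torus_cell R n =
  \bigcap_(i in [set: 'I_n]) ((@tnth _ _ ^~ i) @^-1` `[0, 2 * pi[)).
  apply: fin_bigcap_measurable => // i _.
  by rewrite -[X in measurable X]setTI; exact: measurable_tnth.
by apply/seteqP; split=> t /= H i; [move=> _|]; exact: H.
Qed.

Lemma torus_cell_measure n : (lebesgue_measure_n R n (@torus_cell R n) < +oo)%E.
Proof.
rewrite (@lebesgue_measure_n_box R n (fun=> `[0, 2 * pi[%classic))//.
under eq_bigr do rewrite lebesgue_measure_itv/= lte_fin mulr_gt0 ?pi_gt0// -EFinB.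
by rewrite prodEFin ltry.
Qed.

Lemma measurable_phase n (u : 'rV[R]_n) (theta : R) (D : set (n.-tuple mR)) :
  measurable_fun D (fun t : n.-tuple mR => cos (theta + inner u (row_of_tuple t))).
Proof.
apply: measurable_funTS; apply: measurableT_comp.
  exact: continuous_measurable_fun (@continuous_cos R).
apply: measurable_funD => //; apply: measurable_sum => s.
apply: measurable_funM => //.
by under eq_fun do rewrite mxE; exact: measurable_tnth.
Qed.

Lemma integrable_cos_torus n (u : 'rV[R]_n) (theta : R) :
  (lebesgue_measure_n R n).-integrable (@torus_cell R n)
    (fun t => (cos (theta + inner u (row_of_tuple t)))%:E).
Proof.
apply: measurable_bounded_integrable.
- exact: measurable_torus_cell.
- exact: torus_cell_measure.
- exact: measurable_phase.
- exists 1; split=> // M M1 t _ /=.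
  by rewrite (le_trans _ (ltW M1))// ler_norml cos_geN1 cos_le1.
Qed.

(** Orthogonality of the characters. The phase lets the induction close: with the first coordinate
    [x] fixed, the term [m 0 0 * x] joins [theta], and the remaining coordinates are again of the
    same form. *)
Lemma integral_cos_torus n (m : 'rV[int]_n) (theta : R) :
  (\int[lebesgue_measure_n R n]_(t in @torus_cell R n)
     (cos (theta + inner (ivec R m) (row_of_tuple t)))%:E =
   ((m == 0)%:R * ((2 * pi) ^+ n * cos theta))%:E)%E.
Proof.
elim: n => [|n IHn] in m theta *.
  (* In dimension 0 the measure is the unit mass at the empty tuple, and the only [m] is 0. *)
  rewrite integral_dirac/=; last 2 first.
  - exact: measurable_torus_cell.
  - by apply/measurable_EFinP; exact: measurable_phase.
  rewrite diracE mem_set ?mul1e; last by case.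
  by rewrite /inner big_ord0 addr0 thinmx0 eqxx mul1r expr0 mul1r.
pose m' : 'rV[int]_n := \row_i m 0 (lift ord0 i).
have phaseE (x : mR) (t : n.-tuple mR) :
    theta + inner (ivec R m) (row_of_tuple (tcons (x, t))) =
    theta + (m 0 0)%:~R * x + inner (ivec R m') (row_of_tuple t).
  rewrite -addrA; congr (_ + _); rewrite /inner big_ord_recl !mxE tnth0.
  by congr (_ + _); apply: eq_bigr => i _; rewrite !mxE tnthS.
have cellE : @tcons R n @^-1` @torus_cell R n.+1 =
    `[0, 2 * pi[%classic `*` @torus_cell R n.
  apply/seteqP; split=> [[x t]/= H|[x t]/= [H0 H] i].
    split; first by have := H ord0; rewrite tnth0.
    by move=> i; have := H (lift ord0 i); rewrite tnthS.
  by case: (unliftP ord0 i) => [j|] ->; rewrite ?tnthS ?tnth0.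
have m0E : (m == 0) = (m' == 0) && (m 0 0 == 0).
  apply/eqP/andP => [m0|[/eqP m'0 /eqP m00]].
    split; last by rewrite m0 mxE.
    by apply/eqP/rowP => i; rewrite !mxE m0 mxE.
  apply/rowP => i; rewrite [RHS]mxE; case: (unliftP ord0 i) => [j|] -> //.
  by have := congr1 (fun v : 'rV_n => v 0 j) m'0; rewrite !mxE.
have int_tcons : (@lebesgue_measure R \x lebesgue_measure_n R n)%E.-integrable
    (@tcons R n @^-1` @torus_cell R n.+1)
    ((fun t => (cos (theta + inner (ivec R m) (row_of_tuple t)))%:E) \o @tcons R n).
  pose f z := cos (theta + inner (ivec R m) (row_of_tuple (@tcons R n z))).
  apply: (@measurable_bounded_integrable _ _ _ _ f).
  - rewrite cellE; apply: measurableX; first exact: measurable_itv.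
    exact: measurable_torus_cell.
  - exact: (torus_cell_measure n.+1).
  - apply: measurable_funTS.
    exact: measurableT_comp (@measurable_phase _ (ivec R m) theta setT)
      (@measurable_tcons R n).
  - exists 1; split=> // M M1 t _ /=.
    by rewrite (le_trans _ (ltW M1))// ler_norml cos_geN1 cos_le1.
rewrite /= /lebesgue_cons integral_pushforward; last 4 first.
- exact: measurable_tcons.
- by apply/measurable_EFinP; exact: measurable_phase.
- exact: int_tcons.
- exact: measurable_torus_cell.
rewrite cellE in int_tcons *; rewrite integral_setX; last 3 first.
- exact: measurable_itv.
- exact: measurable_torus_cell.
- exact: int_tcons.
under eq_integral => x _.
  under eq_integral => t _ do rewrite /= phaseE.
  rewrite IHn; over.
(* The inner integral vanishes unless [m'] is 0; then a one-dimensional cosine in the first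
   coordinate is left. *)
rewrite /= m0E; have [_|_] := eqVneq m' 0; last first.
  by under eq_integral do rewrite mul0r; rewrite integral0 mul0r.
under eq_integral do rewrite mul1r EFinM.
rewrite integralZl//; last first.
  apply: measurable_bounded_integrable => //.
  - rewrite /= lebesgue_measure_itv/= lte_fin mulr_gt0 ?pi_gt0//.
    by rewrite -EFinB ltry.
  - apply: measurable_funTS; apply: measurableT_comp.
      exact: continuous_measurable_fun (@continuous_cos R).
    by apply: measurable_funD => //; apply: measurable_funM.
  - exists 1; split=> // M M1 t _ /=.
    by rewrite (le_trans _ (ltW M1))// ler_norml cos_geN1 cos_le1.
rewrite integral_cos_affine -EFinM /=; congr EFin.
by rewrite exprS; ring.
Qed.

End TorusIntegral.

(** * The integrated trace *)

Section IntegratedTrace.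
Variables (R : realType) (d : nat) (G : periodic_graph R d).

Lemma torus_integral_trace n : (0 < n)%N ->
  torus_integral (fiber_trace G n) =
  ((2 * pi) ^+ d * (ncycles_index G n 0)%:R)%:C.
Proof.
move=> n0; rewrite /torus_integral.
under eq_Rintegral => t _ do rewrite fiber_trace_cos//=.
under [X in _ +i* X]eq_Rintegral => t _ do rewrite fiber_trace_cos//=.
rewrite /Rintegral integral0 /= -[RHS]/(_ +i* 0); congr (_ +i* _).
under eq_integral => t _ do rewrite -sumEFin.
rewrite integral_sum; last 2 first.
- exact: measurable_torus_cell.
- move=> c; have := integrable_cos_torus (ivec R (cycle_index c)) 0.
  by under eq_fun do rewrite add0r.
under eq_bigr => c _.
  under eq_integral do rewrite -[inner _ _]add0r.
  rewrite integral_cos_torus cos0 mulr1; over.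
rewrite sumEFin /= -mulr_suml mulrC; congr (_ * _).
rewrite -natr_sum; congr _%:R; rewrite /ncycles_index -sum1_card.
rewrite [RHS]big_mkcond [LHS]big_mkcond; apply: eq_bigr => c _; rewrite [in RHS]inE.
by case: (c \in _) => //=; case: eqP.
Qed.

Lemma torus_integral_trace_eq0 n : (0 < n)%N ->
  (torus_integral (fiber_trace G n) = 0) <-> ncycles_index G n 0 = 0%N.
Proof.
move=> n0; rewrite torus_integral_trace//; split=> [[/eqP]|->]; last by rewrite mulr0.
have pi2 : 2 * pi != 0 :> R by rewrite mulf_neq0// gt_eqF// pi_gt0.
by rewrite mulf_eq0 expf_eq0 (negbTE pi2) andbF pnatr_eq0 => /eqP.
Qed.

End IntegratedTrace.

(** * Lifting walks from the quotient, and the two bipartiteness criteria *)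

Section Lifting.
Variables (R : realType) (d : nat) (G : periodic_graph R d).
Let H := fundamental_graph G.

Lemma walk_proj (x y : vertex G) p : walk x p y ->
  @walk H (vproj x) (map (@eproj R d G) p) (vproj y).
Proof.
elim: p x => [x ->//|e p IHp x /= [<- /IHp]].
by rewrite qsrcE qtgtE.
Qed.

(** The edge indices telescope, so the index of a projected walk is the lattice displacement between
    the cells of its ends. *)
Lemma cycle_index_proj (x y : vertex G) p : walk x p y ->
  cycle_index (map (@eproj R d G) p) = vcell y - vcell x.
Proof.
rewrite /cycle_index; elim: p x => [x /= ->|e p IHp x /= [<- /IHp]].
  by rewrite big_nil subrr.
by rewrite big_cons => ->; rewrite qtauE /etau addrC subrKA.
Qed.

Lemma walk_lift (P : seq (qedge G)) X Y (x : vertex G) :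
  @walk H X P Y -> vproj x = X ->
  exists p y, [/\ walk x p y, map (@eproj R d G) p = P & vproj y = Y].
Proof.
elim: P X x => [|E P IHP] X x /=; first by move=> <- xX; exists [::], x.
move=> [<- wP] xE; have [e eE] := eproj_surj E.
rewrite -eE qsrcE in xE; have [m sm] := (vproj_eq _ _).1 xE.
(* The chosen representative starts at [vshift m x], so it is translated back by [m]. *)
pose e' := eshift (- m) e.
have e'E : eproj e' = E by rewrite -eE; apply/esym/eproj_eq; exists (- m).
have se' : src e' = x by rewrite src_eshift sm -vshiftD addNr vshift0.
have [|p [y [pw pP yY]]] := IHP (qtgt E) (tgt e') wP; first by rewrite -qtgtE e'E.
by exists (e' :: p), y; split=> //=; rewrite e'E pP.
Qed.

Lemma connected_fundamental_graph : connected_graph H.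
Proof.
move=> X Y; have [x <-] := vproj_surj X; have [y <-] := vproj_surj Y.
have [p /walk_proj pw] := pg_connected x y.
by exists (map (@eproj R d G) p).
Qed.

Lemma bwalkP X (P : seq (qedge G)) Y :
  reflect (@walk H X P Y) (bwalk (@qsrc R d G) (@qtgt R d G) X P Y).
Proof.
apply: (iffP idP); elim: P X => [|E P IHP] X /=.
- by move/eqP.
- by move=> /andP[/eqP <- /IHP].
- by move=> ->.
- by move=> [<- /IHP ->]; rewrite eqxx.
Qed.

Lemma mem_cyclesP n (c : n.-tuple (qedge G)) : (0 < n)%N ->
  reflect (exists X, @walk H X c X) (c \in cycles G n).
Proof.
case: n c => // n c _; rewrite inE.
case/tupleP: c => E c; rewrite -[cycle _ _]/(cycle _ (E :: c)) bwalk_cycle.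
apply: (iffP idP) => [/bwalkP wc|[X wX]]; first by exists (qsrc E).
by apply/bwalkP; have [EX _] := wX; rewrite -[qsrc E]/(@src H E) EX.
Qed.

Lemma ncycles_eq0 n : (0 < n)%N -> ncycles G n = 0%N <->
  forall X p, @walk H X p X -> size p <> n.
Proof.
move=> n0; split=> [/card0_eq c0 X p pX np|noc].
  have := c0 (Tuple (introT eqP np)); rewrite [RHS]inE => /negP; apply.
  by apply/mem_cyclesP => //; exists X.
apply: eq_card0 => c; apply/negP => /mem_cyclesP-/(_ n0)[X cX].
by apply: (noc X c cX); rewrite size_tuple.
Qed.

(* A closed walk of the quotient lifts to a walk of the periodic graph, which is
   closed precisely when the index vanishes. *)
Lemma ncycles_index0_eq0 n : (0 < n)%N -> ncycles_index G n 0 = 0%N <->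
  forall (x : vertex G) p, walk x p x -> size p <> n.
Proof.
move=> n0; split=> [/card0_eq c0 x p px np|noc].
  have npE : size (map (@eproj R d G) p) == n by rewrite size_map np.
  have := c0 (Tuple npE); rewrite [RHS]inE => /negP; apply.
  rewrite inE /= (cycle_index_proj px) subrr eqxx andbT.
  by apply/mem_cyclesP => //; exists (vproj x); exact: walk_proj.
apply: eq_card0 => c; apply/negP => cC.
have /andP[/mem_cyclesP-/(_ n0)[X cX] /eqP ci0] :
    (c \in cycles G n) && (cycle_index c == 0) by move: cC; rewrite !inE.
have [x xX] := vproj_surj X; have [p [y [py pc yX]]] := walk_lift cX xX.
have yx : y = x.
  have [m ym] := (vproj_eq _ _).1 (etrans xX (esym yX)).
  have := cycle_index_proj py; rewrite pc ci0 ym vcell_vshift.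
  by rewrite addrAC subrr add0r => <-; rewrite vshift0.
rewrite yx in py; apply: (noc x p py).
by rewrite -(size_map (@eproj R d G)) pc size_tuple.
Qed.

Lemma bipartite_fundamental_graphP : bipartite H <->
  forall n, odd n -> (n <= nu G)%N -> fiber_trace G n 0 = 0.
Proof.
have trace0 n : odd n -> (fiber_trace G n 0 = 0) <-> ncycles G n = 0%N.
  move=> on; rewrite fiber_trace0 ?odd_gt0//; split=> [/eqP|->//].
  by rewrite pnatr_eq0 => /eqP.
rewrite bipartiteP; last exact: connected_fundamental_graph.
split=> [even_c n on _|tr0 X p pX].
  apply/trace0 => //; apply/ncycles_eq0; first exact: odd_gt0.
  by move=> X p /even_c ep np; rewrite np on in ep.
apply/negP => op.
have [Y [q [qY oq qnu]]] :=
  @short_odd_closed_walk (qvertex G) H id (@inj_id _) _ _ pX op.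
have /trace0-/(_ oq) := tr0 _ oq qnu.
by move=> /ncycles_eq0-/(_ (odd_gt0 oq))/(_ _ _ qY).
Qed.

Lemma bipartite_periodic_graphP : bipartite G <->
  forall n, odd n -> torus_integral (fiber_trace G n) = 0.
Proof.
rewrite bipartiteP; last exact: pg_connected.
split=> [even_c n on|tr0 x p px].
  apply/torus_integral_trace_eq0; rewrite ?odd_gt0//.
  apply/ncycles_index0_eq0; rewrite ?odd_gt0//.
  by move=> x p /even_c ep np; rewrite np on in ep.
apply/negP => op; have /torus_integral_trace_eq0 := tr0 _ op.
by move=> /(_ (odd_gt0 op))/ncycles_index0_eq0-/(_ (odd_gt0 op))/(_ _ _ px).
Qed.

End Lifting.

(* The Cayley graph of Z^d for the unit vectors together with [L] times the first
   one: a closed walk of odd length must use the long edges an odd number of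
   times when [L] is even, hence contains at least [L] unit edges. *)
Section LongEdgeGraph.
Variables (R : realType) (d K : nat).
Let L := K.*2.
Local Notation vec := 'rV[int]_d.+1.
Local Notation unit_vec i := (delta_mx 0 i : vec).

Definition long_step (g : option 'I_d.+1) : vec :=
  if g is Some i then unit_vec i else unit_vec 0 *+ L.

(** Base point, generator, direction, with [None] as the long generator. The Boolean keeps the two
    orientations apart even when [L = 0] turns the long edges into loops. *)
Definition long_edge : Type := (vec * option 'I_d.+1 * bool)%type.

Definition long_src (e : long_edge) : vec :=
  if e.2 then e.1.1 else e.1.1 + long_step e.1.2.
Definition long_tgt (e : long_edge) : vec :=
  if e.2 then e.1.1 + long_step e.1.2 else e.1.1.
Definition long_inv (e : long_edge) : long_edge := (e.1, ~~ e.2).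

Lemma long_inv_involutive e : long_inv (long_inv e) = e.
Proof. by case: e => xg b; rewrite /long_inv /= negbK. Qed.

Lemma long_inv_neq e : long_inv e <> e.
Proof. by case: e => xg []. Qed.

Lemma long_src_inv e : long_src (long_inv e) = long_tgt e.
Proof. by case: e => xg []. Qed.

Definition long_graph : graph :=
  @Graph vec long_edge long_src long_tgt long_inv
    long_inv_involutive long_inv_neq long_src_inv.

Lemma long_graph_steps (k : nat) (x : vec) :
  exists2 p, @walk long_graph x p (x + unit_vec 0 *+ k) & size p = k.
Proof.
elim: k x => [|k IHk] x; first by exists [::]; rewrite //= mulr0n addr0.
have [p pw pk] := IHk (x + unit_vec 0).
exists ((x, Some 0, true) :: p); last by rewrite /= pk.
by rewrite mulrS addrA.
Qed.

(** The displacements that can be realised from every starting point form a subgroup, and it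
    contains the unit vectors. *)
Lemma long_graph_connected : connected_graph long_graph.
Proof.
pose reach (m : vec) := forall x : vec, exists p, @walk long_graph x p (x + m).
have reachD m m' : reach m -> reach m' -> reach (m + m').
  move=> rm rm' x; have [p pw] := rm x; have [q qw] := rm' (x + m).
  by exists (p ++ q); rewrite addrA; exact: walk_cat pw qw.
have reach0 : reach 0 by move=> x; exists [::]; rewrite /= addr0.
have reachN m : reach m -> reach (- m).
  move=> rm x; have [p pw] := rm (x - m).
  by exists (rev (map (@Defs.inv long_graph) p)); rewrite subrK in pw; exact: walk_rev.
have reachZ (a : int) i : reach (a *: unit_vec i).
  have reachn (n : nat) : reach (unit_vec i *+ n).
    elim: n => [|n IHn]; first by rewrite mulr0n.
    rewrite mulrS; apply: reachD => // x.
    by exists [:: (x, Some i, true)].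
  rewrite -(intz a) scaler_int; case: a => n; first exact: reachn.
  by rewrite NegzE mulrNz; exact/reachN/reachn.
move=> x y; have : reach (y - x).
  by rewrite [y - x]row_sum_delta; elim/big_rec: _ => // i m _; exact: reachD.
by move=> /(_ x)[p]; rewrite subrKC; exists p.
Qed.

Lemma long_graph_infinite : infinite_set [set: vertex long_graph].
Proof.
move=> finT; apply: infinite_nat.
have inj : injective (fun n : nat => unit_vec 0 *+ n : vec).
  move=> n n' /rowP/(_ 0); rewrite !mulmxnE mxE eqxx /= => /eqP.
  by rewrite eqr_nat => /eqP.
rewrite -(preimage_setT (fun n : nat => unit_vec 0 *+ n : vertex long_graph)).
by apply: finite_preimage => // n n' _ _; exact: inj.
Qed.

Lemma long_graph_locally_finite : locally_finite long_graph.
Proof.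
move=> x; apply: (@sub_finite_set _ _ (range (fun gb : option 'I_d.+1 * bool =>
    ((if gb.2 then x else x - long_step gb.1, gb.1), gb.2) : long_edge))).
  move=> [[y g] b] /= <-; exists (g, b) => //=.
  by rewrite /long_src /=; case: b => //=; rewrite addrK.
exact: finite_image.
Qed.

Definition long_eshift (m : vec) (e : long_edge) : long_edge :=
  (m + e.1.1, e.1.2, e.2).

Lemma ivec_inj : injective (@ivec R d.+1).
Proof.
move=> u v /rowP uv; apply/rowP => i.
by have := uv i; rewrite !mxE => /intr_inj.
Qed.

Lemma ivec_shift (m x : vec) : ivec R (m + x) = ivec R x + ivec R m *m 1%:M.
Proof. by rewrite mulmx1 addrC ivecD. Qed.

Lemma long_eshift0 e : long_eshift 0 e = e.
Proof. by case: e => [[x g] b]; rewrite /long_eshift add0r. Qed.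

Lemma long_eshiftD (m m' : vec) e :
  long_eshift (m + m') e = long_eshift m (long_eshift m' e).
Proof. by rewrite /long_eshift addrA. Qed.

Lemma long_src_eshift (m : vec) e : long_src (long_eshift m e) = m + long_src e.
Proof. by case: e => [[x g] []]; rewrite /long_src //= addrA. Qed.

Lemma long_vquot_finite :
  finite_set (range (fun x : vec => range (fun m : vec => m + x))).
Proof.
apply: (@sub_finite_set _ _ [set setT]); last exact: finite_set1.
move=> _ [x _ <-] /=; apply/seteqP; split=> // y _.
by exists (y - x) => //; rewrite subrK.
Qed.

Lemma long_equot_finite : finite_set (range (fun e => range (long_eshift ^~ e))).
Proof.
apply: (@sub_finite_set _ _ (range (fun gb : option 'I_d.+1 * bool =>
    range (long_eshift ^~ ((0 : vec, gb.1), gb.2))))); last exact: finite_image.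
move=> _ [[[x g] b] _ <-]; exists (g, b) => //=.
apply/seteqP; split=> _ [m _ <-].
  by exists (m - x) => //; rewrite /long_eshift /= subrK addr0.
by exists (m + x) => //; rewrite /long_eshift /= addr0.
Qed.

Definition long_periodic_graph : periodic_graph R d.+1 :=
  @PeriodicGraph R d.+1 long_graph 1%:M (unitmx1 _ _) (@ivec R d.+1) ivec_inj
    (fun m x => m + x) long_eshift ivec_shift long_eshift0 long_eshiftD
    long_src_eshift (fun _ _ => erefl) long_graph_connected long_graph_infinite
    long_graph_locally_finite long_vquot_finite long_equot_finite.

Lemma long_graph_odd_closed_walk (x : vertex long_graph) p :
  walk x p x -> odd (size p) -> (L < size p)%N.
Proof.
pose csum (y : vec) := \sum_i y 0 i.
have csumD y z : csum (y + z) = csum y + csum z.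
  by rewrite -big_split; apply: eq_bigr => i _; rewrite mxE.
have csum_unit i : csum (unit_vec i) = 1.
  rewrite /csum (bigD1 i)//= mxE !eqxx big1 ?addr0// => j /negbTE ji.
  by rewrite mxE eqxx ji.
have csum_long : csum (unit_vec 0 *+ L) = L%:Z.
  elim: L => [|k IHk]; last by rewrite mulrS csumD csum_unit IHk; lia.
  by rewrite /csum big1// => i _; rewrite mxE.
(* [a] and [B] count the unit and the long edges of the walk, and [b] counts the long ones with
   sign; [c] and [c'] witness two congruences modulo 2. The coordinate sum changes by [a] modulo 2
   because [L] is even, and unit edges move the first coordinate by at most [a]. *)
have inv (y z : vec) q : @walk long_graph y q z ->
    exists (a B : nat) (b c c' : int),
    [/\ size q = (a + B)%N, csum z = csum y + a%:Z + 2 * c,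
      b = B%:Z + 2 * c',
      z 0 0 - y 0 0 - L%:Z * b <= a%:Z & - a%:Z <= z 0 0 - y 0 0 - L%:Z * b].
  elim: q y => [y /= ->|[[y' g] s] q IHq y /= [<- /IHq]].
    by exists 0%N, 0%N, 0, 0, 0; split; lia.
  move=> [a [B [b [c [c' [-> -> bE le1 le2]]]]]].
  have LE : (unit_vec 0 *+ L : vec) 0 0 = L%:Z by rewrite mulmxnE mxE !eqxx -[RHS]natz.
  have L2 : L%:Z = 2 * K%:Z by rewrite /L; lia.
  have i0E i : (unit_vec i : vec) 0 0 = 0 \/ (unit_vec i : vec) 0 0 = 1.
    by rewrite mxE eqxx; case: eqP; [right|left].
  have addE (u v : vec) : (u + v) 0 0 = u 0 0 + v 0 0 by rewrite mxE.
  case: g le1 le2 => [i|]; rewrite /long_src /long_tgt /=; case: s => /=;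
    rewrite ?csumD ?csum_unit ?csum_long !addE ?LE => le1 le2.
  - by exists a.+1, B, b, c, c'; case: (i0E i) le1 le2 => ->; split; lia.
  - by exists a.+1, B, b, (c - 1), c'; case: (i0E i) le1 le2 => ->; split; lia.
  - exists a, B.+1, (b + 1), (c + K%:Z), c'.
    by rewrite mulrDr; split; lia.
  - exists a, B.+1, (b - 1), (c - K%:Z), (c' - 1).
    by rewrite mulrBr; split; lia.
move=> /inv[a [B [b [c [c' [-> cs bE le1 le2]]]]]].
rewrite oddD => oaB.
(* For a closed walk [a] is even, so [B] and with it [b] are odd. Thus [b] is nonzero, [L] is at
   most [a], and [B] adds at least one more edge. *)
have oa : ~~ odd a by lia.
have b0 : b <> 0 by lia.
nia.
Qed.

(** [L] unit edges out and one long edge back close up after the odd number [L + 1] of edges. *)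
Lemma long_graph_not_bipartite : ~ bipartite long_graph.
Proof.
move=> bip; have [p pw pL] := long_graph_steps L 0.
have e : @walk long_graph (0 + unit_vec 0 *+ L) [:: (0, None, false)] 0 by [].
have := bipartite_closed_walk bip (walk_cat pw e).
by rewrite size_cat pL addn1 /= odd_double.
Qed.

End LongEdgeGraph.

(** * Positivity of the dimension and assembly of the theorem *)

(** An infinite vertex set does not embed into the single point of dimension 0. This makes room for
    the long edges, which need a first coordinate. *)
Lemma periodic_graph_dim_gt0 (R : realType) (d : nat) (G : periodic_graph R d) :
  (0 < d)%N.
Proof.
case: d G => // G; case: (@pg_infinite _ _ G).
rewrite -(preimage_setT (@pos _ _ G)); apply: finite_preimage.
  by move=> x y _ _; exact: pos_inj.
apply: (@sub_finite_set _ _ [set 0]); last exact: finite_set1.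
by move=> u _ /=; rewrite thinmx0.
Qed.

Theorem theorem2p2 (R : realType) (d : nat) (G : periodic_graph R d) :
  (forall n : nat, (0 < n)%N ->
    (* (i) *)
    [/\ forall k : 'rV[R]_d,
          [/\ forall lam : 'I_(nu G) -> R[i],
                eigenvalues_of (fiber_adj G k) lam ->
                fiber_trace G n k = \sum_j lam j ^+ n,
              fiber_trace G n k =
                (\sum_(c in cycles G n)
                   cos (inner (ivec R (cycle_index c)) k))%:C,
              fiber_trace G n k =
                (\sum_(m \in [set m : 'rV[int]_d |
                               enorm (ivec R m) <= n%:R * tau_plus G])
                   (ncycles_index G n m)%:R * cos (inner (ivec R m) k))%:C
            & `|fiber_trace G n k| <= fiber_trace G n 0],
        fiber_trace G n 0 = (ncycles G n)%:R,
    (* (ii) *)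
        ((2 * pi) ^+ d)^-1%:C * torus_integral (fiber_trace G n) =
          (ncycles_index G n 0)%:R
      & (0 : R[i]) <= (ncycles_index G n 0)%:R]) /\
  (* (iii) *)
  (bipartite (fundamental_graph G) <->
    (forall n : nat, odd n -> (n <= nu G)%N -> fiber_trace G n 0 = 0)) /\
  (* (iv) *)
  (bipartite G <->
    (forall n : nat, odd n -> torus_integral (fiber_trace G n) = 0)) /\
  (forall s : nat, exists G' : periodic_graph R d,
    ~ bipartite G' /\
    (forall n : nat, odd n -> (n < s)%N ->
       torus_integral (fiber_trace G' n) = 0)).
Proof.
split=> [n n0|].
  have pi2 : (2 * pi) ^+ d != 0 :> R.
    by rewrite expf_neq0// mulf_neq0// gt_eqF// pi_gt0.
  split.
  - move=> k; split.
    + by move=> lam; exact: mxtrace_exp_eigenvalues.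
    + exact: fiber_trace_cos.
    + by rewrite fiber_trace_cos// sum_cycles_by_index.
    + exact: norm_fiber_trace_le.
  - exact: fiber_trace0.
  - by rewrite torus_integral_trace// -rmorphM mulrA mulVf// mul1r rmorph_nat.
  - exact: ler0n.
split; first exact: bipartite_fundamental_graphP.
split; first exact: bipartite_periodic_graphP.
move=> s; have := periodic_graph_dim_gt0 G; case: d G => // d _ _.
(* The long edge spans [2 * s] unit steps, so odd closed walks are longer than [2 * s], and no odd
   [n] below [s] is the length of one. *)
exists (long_periodic_graph R d s); split; first exact: long_graph_not_bipartite.
move=> n on ns; apply/torus_integral_trace_eq0; first exact: odd_gt0.
apply/ncycles_index0_eq0; first exact: odd_gt0.
move=> x p px np; have := long_graph_odd_closed_walk px.
rewrite np => /(_ on); rewrite ltnNge => /negP; apply.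
by rewrite (leq_trans (ltnW ns))// -addnn leq_addr.
Qed.
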